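(* Let $k$ be a field and let $C_n$ be the cycle graph on $n\ge3$ vertices $1,\dots,n$, i.e. the graph with edges $\{i,i+1\}$ for $1\le i\le n-1$ together with the edge $\{1,n\}$. Then $n-1\le\operatorname{cs}(k(C_n))\le n$ and $\operatorname{ms}(k(C_n))\ge\left\lfloor\frac n2\right\rfloor$. If $n\ge3$ is odd, then $\operatorname{cs}(k(C_n))=n-1$. If $n=3$, then $\operatorname{ms}(k(C_n))=\left\lfloor\frac n2\right\rfloor$. For $n\le7$, we have $\operatorname{ms}(k(C_n))\le\left\lceil\frac n2\right\rceil$, and equality holds for $n=4$ and $n=6$.
   Context: For a finite simple graph $G$ on $\{1,\dots,n\}$, the edge ring over $k$ is $k(G)=k[x_1,\dots,x_n]/I(G)$, where $I(G)=(x_ix_j\mid\{i,j\}\text{ is an edge of }G)$; it is standard graded with homogeneous maximal ideal $\bar{\mathfrak m}$ (the image of $(x_1,\dots,x_n)$). For a homogeneous ideal $J$ of $k(G)$, $\mu(J)=\dim_k(J/\bar{\mathfrak m}J)$, and $$\operatorname{cs}(k(G))=\min\{\mu(J): J\subseteq\bar{\mathfrak m} \text{ homogeneous with } J^2=\bar{\mathfrak m}^2\},\qquad \operatorname{ms}(k(G))=\min\{\mu(J): J\subseteq \bar{\mathfrak m} \text{ homogeneous with } J\supseteq \bar{\mathfrak m}^2\}.$$ *)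

(* Defs.v *)
From HB Require Import structures.
From mathcomp Require Import all_boot all_order all_algebra.
From mathcomp Require Import boolp classical_sets.
From mathcomp Require Import mpoly.

Set Implicit Arguments.
Unset Strict Implicit.
Unset Printing Implicit Defensive.

Import GRing.Theory.
Local Open Scope ring_scope.
Local Open Scope classical_set_scope.
Local Open Scope quotient_scope.

Section Ideals.
Variable R : comNzRingType.

Definition is_ideal (J : set R) : Prop :=
  [/\ J 0, forall f g, J f -> J g -> J (f + g) & forall a f, J f -> J (a * f)].

Definition ideal_gen (S : set R) : set R :=
  [set f | exists s : seq (R * R),
     (forall x, x \in s -> S x.2) /\ f = \sum_(x <- s) x.1 * x.2].

Definition ideal_mul (I J : set R) : set R :=
  ideal_gen [set h | exists f g, [/\ I f, J g & h = f * g]].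

Lemma ideal_genP S : is_ideal (ideal_gen S).
Proof.
split=> [|f g [s [sS ->]] [t [tS ->]]|a f [s [sS ->]]].
- by exists [::]; rewrite big_nil.
- exists (s ++ t); rewrite big_cat; split=> // x.
  by rewrite mem_cat => /orP[/sS|/tS].
exists [seq (a * x.1, x.2) | x <- s]; split=> [x /mapP[y /sS Sy ->] //|].
by rewrite big_map big_distrr; apply: eq_bigr => x _ /=; rewrite mulrA.
Qed.

Lemma ideal_gen_sub S J : is_ideal J -> S `<=` J -> ideal_gen S `<=` J.
Proof.
move=> [J0 JD JM] SJ f [s [sS ->]]; rewrite big_seq.
by elim/big_ind: _ => // x /sS/SJ; apply: JM.
Qed.

Lemma sub_ideal_gen S : S `<=` ideal_gen S.
Proof.
move=> f Sf; exists [:: (1, f)]; rewrite big_seq1 /= mul1r; split=> // x.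
by rewrite inE => /eqP->.
Qed.

End Ideals.

(* For subspaces [W <= U] of [V]: the quotient space [U / W] has dimension [d],
   i.e. the classes of some [b_1, ..., b_d] in [U] form a basis of it. *)
Definition has_quot_dim (k : fieldType) (V : lmodType k) (U W : set V)
    (d : nat) : Prop :=
  exists b : 'I_d -> V,
    [/\ forall i, U (b i),
        forall f, U f -> exists c : 'I_d -> k, W (f - \sum_i c i *: b i)
      & forall c : 'I_d -> k, W (\sum_i c i *: b i) -> forall i, c i = 0].

Record sgraph (n : nat) := SGraph {
  adj :> rel 'I_n;
  adj_sym : ssrbool.symmetric adj;
  adj_irrefl : irreflexive adj
}.

Section EdgeRing.
Variables (k : fieldType) (n : nat) (G : sgraph n).
Local Notation S := {mpoly k[n]}.

Definition edge_monomials : set S :=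
  [set p | exists i j : 'I_n, G i j /\ p = 'X_i * 'X_j].

(* Membership is made boolean classically, as [{ideal_quot _}] requires. *)
Definition edge_ideal : S -> bool := fun p => `[< ideal_gen edge_monomials p >].

(* Polynomials without constant and linear terms. *)
Let ord2 : set S :=
  [set p | p.@[fun=> 0] = 0 /\ forall i, (p^`M(i)).@[fun=> 0] = 0].

Let ord2_ideal : is_ideal ord2.
Proof.
split=> [|p q [p0 p1] [q0 q1]|a p [p0 p1]].
- by split=> [|i]; rewrite ?mderiv0 meval0.
- by split=> [|i]; rewrite ?mderivD mevalD ?p0 ?q0 ?p1 ?q1 addr0.
by split=> [|i]; rewrite ?mderivM ?mevalD !mevalM ?p0 ?p1 !mulr0 ?addr0.
Qed.

Let ord2M p q : p.@[fun=> 0] = 0 -> q.@[fun=> 0] = 0 -> ord2 (p * q).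
Proof.
move=> p0 q0; split=> [|i]; rewrite ?mderivM ?mevalD !mevalM p0 q0.
  by rewrite mulr0.
by rewrite mulr0 mul0r addr0.
Qed.

Let edge_ideal_ord2 p : edge_ideal p -> ord2 p.
Proof.
move=> /asboolP; apply: ideal_gen_sub => // q [i [j [_ ->]]].
by apply: ord2M; rewrite mevalXU.
Qed.

Lemma edge_idealP : idealr_closed edge_ideal.
Proof.
have [I0 ID IM] := ideal_genP edge_monomials.
split; first exact/asboolP.
  apply/negP => /edge_ideal_ord2[/eqP].
  by rewrite meval1 oner_eq0.
by move=> a u v /asboolP uI /asboolP vI; apply/asboolP/ID => //; apply: IM.
Qed.

HB.instance Definition _ := isIdealr.Build S edge_ideal edge_idealP.

Definition edge_ring := {ideal_quot (edge_ideal : idealr S)}.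

HB.instance Definition _ := GRing.ComNzRing.on edge_ring.
HB.instance Definition _ := NzRingQuotient.on edge_ring.

Definition edge_proj : S -> edge_ring := \pi_edge_ring.

HB.instance Definition _ := GRing.RMorphism.on edge_proj.

Lemma edge_projP (p q : S) :
  edge_proj p = edge_proj q <-> ideal_gen edge_monomials (p - q).
Proof.
split=> [/eqP|pq]; last apply/eqP.
  by rewrite -Quotient.idealrBE => /asboolP.
by rewrite -Quotient.idealrBE; apply/asboolP.
Qed.

Lemma edge_proj_surj (f : edge_ring) : exists p, f = edge_proj p.
Proof. by exists (repr f); rewrite /edge_proj reprK. Qed.

Definition edge_scale (c : k) (f : edge_ring) : edge_ring :=
  edge_proj c%:MP * f.

Fact edge_scaleA a b f : edge_scale a (edge_scale b f) = edge_scale (a * b) f.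
Proof. by rewrite /edge_scale mulrA -rmorphM mpolyCM. Qed.

Fact edge_scale1 : left_id 1 edge_scale.
Proof. by move=> f; rewrite /edge_scale mpolyC1 rmorph1 mul1r. Qed.

Fact edge_scaleDr : right_distributive edge_scale +%R.
Proof. by move=> c f g; rewrite /edge_scale mulrDr. Qed.

Fact edge_scaleDl f : {morph edge_scale^~ f : a b / a + b}.
Proof. by move=> a b; rewrite /edge_scale mpolyCD rmorphD mulrDl. Qed.

HB.instance Definition _ := GRing.Zmodule_isLmodule.Build k edge_ring
  edge_scaleA edge_scale1 edge_scaleDr edge_scaleDl.

Fact edge_scaleAl (c : k) (f g : edge_ring) : c *: (f * g) = c *: f * g.
Proof. exact: mulrA. Qed.

HB.instance Definition _ :=
  GRing.Lmodule_isLalgebra.Build k edge_ring edge_scaleAl.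

Fact edge_proj_scalable : scalable edge_proj.
Proof. by move=> c p; rewrite -mul_mpolyC rmorphM. Qed.

HB.instance Definition _ :=
  GRing.isScalable.Build k S edge_ring *:%R edge_proj edge_proj_scalable.

(* The homogeneous elements of degree [d] of the standard graded ring [k(G)]
   are the images of the homogeneous polynomials of degree [d]. *)
Definition is_homog (f : edge_ring) : Prop :=
  exists d (p : S), p \is d.-homog /\ f = edge_proj p.

Definition homog_ideal (J : set edge_ring) : Prop :=
  is_ideal J /\ J = ideal_gen [set f | J f /\ is_homog f].

Definition edge_max : set edge_ring :=
  edge_proj @` ideal_gen [set p | exists i : 'I_n, p = 'X_i].

(* [mu(J) = d]. *)
Definition has_mu (J : set edge_ring) (d : nat) : Prop :=
  has_quot_dim J (ideal_mul edge_max J) d.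

Definition is_cs_val (d : nat) : Prop :=
  exists J, [/\ homog_ideal J, J `<=` edge_max,
    ideal_mul J J = ideal_mul edge_max edge_max & has_mu J d].

Definition is_ms_val (d : nat) : Prop :=
  exists J, [/\ homog_ideal J, J `<=` edge_max,
    ideal_mul edge_max edge_max `<=` J & has_mu J d].

Lemma edge_max_ideal : is_ideal edge_max.
Proof.
have [I0 ID IM] := ideal_genP [set p : S | exists i, p = 'X_i].
split=> [|_ _ [p pI <-] [q qI <-]|a _ [p pI <-]].
- by exists 0; rewrite ?rmorph0.
- by exists (p + q); rewrite ?rmorphD //; apply: ID.
have [b ->] := edge_proj_surj a.
by exists (b * p); rewrite ?rmorphM //; apply: IM.
Qed.

Lemma edge_maxX i : edge_max (edge_proj 'X_i).
Proof. by exists 'X_i => //; apply: sub_ideal_gen; exists i. Qed.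

Lemma edge_max_gen :
  edge_max `<=` ideal_gen [set f | exists i, f = edge_proj 'X_i].
Proof.
move=> _ [_ [s [sS ->]] <-].
exists [seq (edge_proj x.1, edge_proj x.2) | x <- s]; split.
  by move=> x /mapP[y /sS[i ->] ->]; exists i.
by rewrite big_map rmorph_sum; apply: eq_bigr => x _; rewrite rmorphM.
Qed.

Lemma edge_max_homog : homog_ideal edge_max.
Proof.
split; first exact: edge_max_ideal.
apply/seteqP; split; last first.
  by apply: ideal_gen_sub => [|f []//]; exact: edge_max_ideal.
move=> f /edge_max_gen; apply: ideal_gen_sub; first exact: ideal_genP.
move=> _ [i ->]; apply: sub_ideal_gen; split; first exact: edge_maxX.
by exists 1%N, 'X_i; rewrite dhomogX /= mdeg1.
Qed.

Lemma edge_max_mu : has_mu edge_max n.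
Proof.
have [m0 mD mM] := edge_max_ideal.
have [W0 WD WM] : is_ideal (ideal_mul edge_max edge_max) by exact: ideal_genP.
exists (fun i => edge_proj 'X_i); split=> [i|f /edge_max_gen|c].
- exact: edge_maxX.
- pose T : set edge_ring := [set f | exists c : 'I_n -> k,
    ideal_mul edge_max edge_max (f - \sum_i c i *: edge_proj 'X_i)].
  have TD f1 f2 : T f1 -> T f2 -> T (f1 + f2).
    move=> [c1 h1] [c2 h2]; exists (fun i => c1 i + c2 i).
    under eq_bigr do rewrite scalerDl.
    by rewrite big_split opprD addrACA; apply: WD.
  have T0 : T 0.
    exists (fun=> 0); rewrite big1 ?subr0 // => i _; exact: scale0r.
  move=> [s [sX ->]]; rewrite big_seq; apply: (big_ind T) => // -[a x] /sX/=.
  move=> [i ->]; have [p ->] := edge_proj_surj a.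
  rewrite {1}(mpolyE p) rmorph_sum mulr_suml /=; apply: (big_ind T) => // m _.
  rewrite linearZ -scalerAl /=; have [->|mN0] := eqVneq m 0%MM.
    exists (fun j => if j == i then p@_0%MM else 0).
    rewrite (bigD1 i) //= eqxx big1 => [|j /negPf->]; last exact: scale0r.
    by rewrite addr0 mpolyX0 rmorph1 mul1r subrr.
  exists (fun=> 0); rewrite big1 ?subr0 => [|j _]; last exact: scale0r.
  apply: (WM (edge_proj (p@_m)%:MP)); apply: sub_ideal_gen.
  exists (edge_proj 'X_[m]), (edge_proj 'X_i); split=> //; last first.
    exact: edge_maxX.
  have [j mj] : exists j, m j != 0%N.
    apply/existsP; apply: contraNT mN0; rewrite negb_exists => /forallP m_0.
    by apply/eqP/mnmP => j; rewrite mnm0E; apply/eqP/negPn.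
  have -> : m = (m - U_(j) + U_(j))%MM by rewrite submK // lep1mP.
  by rewrite mpolyXD rmorphM; apply: mM; apply: edge_maxX.
move=> Wc; have ord2W : ideal_mul edge_max edge_max `<=` edge_proj @` ord2.
  have [o0 oD oM] := ord2_ideal.
  apply: ideal_gen_sub => [|_ [_ [_ [[p pX <-] [q qX <-] ->]]]].
    split=> [|_ _ [p pI <-] [q qI <-]|a _ [p pI <-]].
    - by exists 0; rewrite ?rmorph0.
    - by exists (p + q); rewrite ?rmorphD //; apply: oD.
    have [b ->] := edge_proj_surj a.
    by exists (b * p); rewrite ?rmorphM //; apply: oM.
  exists (p * q); rewrite ?rmorphM //.
  have X0 : ideal_gen [set p : S | exists i, p = 'X_i]
      `<=` [set p | p.@[fun=> 0] = 0].
    apply: ideal_gen_sub => [|_ [i ->] /=]; last by rewrite mevalXU.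
    by split=> [|f g /= f0 g0|a f /= f0];
      rewrite /= ?meval0 ?mevalD ?mevalM ?f0 ?g0 ?addr0 ?mulr0.
  by apply: ord2M; [exact: (X0 p)|exact: (X0 q)].
have [q q2 qE] := ord2W _ Wc; move=> i.
have cE : edge_proj (\sum_i c i *: 'X_i) = edge_proj q.
  by rewrite qE linear_sum; apply: eq_bigr => j _; rewrite linearZ.
have /edge_projP/asboolP/edge_ideal_ord2 d2 := cE.
have [_ oD _] := ord2_ideal.
have [_ /(_ i)] := oD _ _ d2 q2.
rewrite subrK (linear_sum (mderiv i)) /=.
rewrite raddf_sum /= (bigD1 i) //= big1 => [|j ji].
  by rewrite addr0 mderivZ mevalZ mderivX mnm1E eqxx scale1r
             -[X in (X - _)%MM]add0m addmK mpolyX0 meval1 mulr1.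
by rewrite mderivZ mevalZ mderivX mnm1E (negPf ji) scale0r meval0 mulr0.
Qed.

Lemma cs_val_ex : exists d, `[< is_cs_val d >].
Proof.
exists n; apply/asboolP; exists edge_max.
by split=> //; [exact: edge_max_homog|exact: edge_max_mu].
Qed.

Lemma ms_val_ex : exists d, `[< is_ms_val d >].
Proof.
exists n; apply/asboolP; exists edge_max; split=> //.
- exact: edge_max_homog.
- have mI := edge_max_ideal; apply: ideal_gen_sub => // _ [f [g [_ mg ->]]].
  by case: mI => _ _; apply.
exact: edge_max_mu.
Qed.

Definition cs : nat := ex_minn cs_val_ex.
Definition ms : nat := ex_minn ms_val_ex.

End EdgeRing.

Section CycleGraph.
Variable n : nat.

(* The vertices [1, ..., n] are numbered [0, ..., n.-1]; the condition
   [i != j] only matters for [n = 1]. *)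
Definition cycle_adj : rel 'I_n := fun i j =>
  (i != j) && [|| i.+1 == j :> nat, j.+1 == i :> nat,
                  (i == 0%N :> nat) && (j == n.-1 :> nat)
                | (j == 0%N :> nat) && (i == n.-1 :> nat)].

Fact cycle_adj_sym : ssrbool.symmetric cycle_adj.
Proof.
move=> i j; rewrite /cycle_adj eq_sym; congr (_ && _).
by rewrite orbCA; do 2 congr (_ || _); rewrite orbC.
Qed.

Fact cycle_adj_irrefl : irreflexive cycle_adj.
Proof. by move=> i; rewrite /cycle_adj eqxx. Qed.

Definition cycle_graph : sgraph n := SGraph cycle_adj_sym cycle_adj_irrefl.

End CycleGraph.

(* Main.v *)
Require Import Defs.
From mathcomp Require Import all_boot all_order all_algebra.
From mathcomp Require Import boolp classical_sets mpoly ring zify.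

(* Lower bounds. Let [J] be spanned by [b_1, ..., b_d] modulo [m J]. If [w] is a
   point whose support is an independent set, restriction to the line through
   [w] maps the edge ring to [k[t]]. The [t]-coefficient is linear in [w] and
   vanishes on [m^2], and if [J^2 = m^2] the [t^2]-coefficients of elements of
   [m^2] are combinations of the products [beta_i(w) beta_j(w)], where
   [beta_i] is the linear part of [b_i]. After polarization, the non-edge
   monomials of degree 2, at least [C(n, 2)] in number, are spanned by
   [C(d + 1, 2)] products, so [n <= d + 1].
   If instead [J] contains [m^2], let [I] be an independent set and [W] the
   space of points supported on [I] where all [beta_i] vanish. Squares of
   coordinates on [W] lie in [J]; modulo [m J], which restricts to zero on [W]
   in degree 2, they are combinations of the [b_j] with vanishing linear part
   on [I]. Hence [dim W <= d - (#|I| - dim W)], that is, [#|I| <= d].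
   Upper bounds. Take [J] generated by the differences [x_i - x_(r i)] for an
   idempotent [r]. If [n] is odd and [r] is constant, then
   [(x_t - x_(t+2)) x_i = (x_t - x_(t+2)) (x_i - x_(t+1))] lies in [J^2]; steps
   of length 2 connect an odd cycle, so every [x_j x_i] is congruent to
   [x_(i+1) x_i = 0] modulo [J^2]. For [4 <= n <= 7], merge consecutive vertices
   into at most three classes, any two of which contain adjacent vertices. For
   [n = 3], take [J = (x_1 + x_2 + x_3)]. *)

Set Implicit Arguments.
Unset Strict Implicit.
Unset Printing Implicit Defensive.

Import GRing.Theory.

(** * Closure properties of ideals and their products *)

Section Ideals.
Local Open Scope ring_scope.
Local Open Scope classical_set_scope.

Variable R : comNzRingType.
Implicit Types I J K : set R.

Lemma is_ideal0 I : is_ideal I -> I 0.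
Proof. by case. Qed.

Lemma is_idealD I f g : is_ideal I -> I f -> I g -> I (f + g).
Proof. by case=> _ + _; apply. Qed.

Lemma is_idealMl I a f : is_ideal I -> I f -> I (a * f).
Proof. by case=> _ _; apply. Qed.

Lemma is_idealMr I a f : is_ideal I -> I f -> I (f * a).
Proof. by rewrite mulrC; exact: is_idealMl. Qed.

Lemma is_idealB I f g : is_ideal I -> I f -> I g -> I (f - g).
Proof. by move=> iI If Ig; rewrite -mulN1r; apply: is_idealD => //; apply: is_idealMl. Qed.

Lemma is_ideal_sum I (T : Type) (s : seq T) (P : pred T) (F : T -> R) :
  is_ideal I -> (forall t, P t -> I (F t)) -> I (\sum_(t <- s | P t) F t).
Proof.
move=> iI IF; apply: (big_ind I) => //; first exact: is_ideal0.
by move=> ? ?; apply: is_idealD.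
Qed.

Lemma ideal_mul_ideal I J : is_ideal (ideal_mul I J).
Proof. exact: ideal_genP. Qed.

Lemma ideal_mulM I J f g : I f -> J g -> ideal_mul I J (f * g).
Proof. by move=> If Jg; apply: sub_ideal_gen; exists f, g. Qed.

Lemma ideal_mulS I1 I2 J1 J2 : I1 `<=` I2 -> J1 `<=` J2 ->
  ideal_mul I1 J1 `<=` ideal_mul I2 J2.
Proof.
move=> I12 J12; apply: ideal_gen_sub; first exact: ideal_mul_ideal.
by move=> _ [f [g [/I12 If /J12 Jg ->]]]; apply: ideal_mulM.
Qed.

End Ideals.

(** * Linear parts, and restriction of the edge ring to lines *)

Section EdgeRingTheory.
Local Open Scope ring_scope.
Local Open Scope classical_set_scope.

Variables (k : fieldType) (n : nat) (G : sgraph n).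
Local Notation S := {mpoly k[n]}.
Local Notation A := (edge_ring k G).
Local Notation x i := (edge_proj G ('X_i : S)).
Local Notation m := (@edge_max k n G).

Lemma edge_proj_edge i j : G i j -> x i * x j = 0.
Proof.
move=> Gij; rewrite -rmorphM -[RHS](rmorph0 (edge_proj G)); apply/edge_projP.
by rewrite subr0; apply: sub_ideal_gen; exists i, j.
Qed.

Lemma edge_scaleE (c : k) (f : A) : c *: f = c%:A * f.
Proof. by rewrite -scalerAl mul1r. Qed.

Lemma edge_maxZ (c : k) f : m f -> m (c *: f).
Proof. by rewrite edge_scaleE; apply: is_idealMl; exact: edge_max_ideal. Qed.

Lemma edge_max_monomial (u : 'X_{1..n}) : u != 0%MM -> m (edge_proj G 'X_[u]).
Proof.
move=> u0; have [j uj] : exists j, u j != 0%N.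
  apply/existsP; apply: contraNT u0; rewrite negb_exists => /forallP u_0.
  by apply/eqP/mnmP => j; rewrite mnm0E; apply/eqP/negPn.
have -> : u = (u - U_(j) + U_(j))%MM by rewrite submK // lep1mP.
rewrite mpolyXD rmorphM; apply: is_idealMl; first exact: edge_max_ideal.
exact: edge_maxX.
Qed.

(** Every monomial except the constant one lies in the maximal ideal. This lets scalars replace ring
    coefficients modulo [m J]. *)
Lemma edge_ring_const (f : A) : exists c : k, m (f - c%:A).
Proof.
have mI := edge_max_ideal k G.
have [p ->] := edge_proj_surj f; rewrite {1}(mpolyE p) rmorph_sum /=.
apply: (big_ind (fun f : A => exists c : k, m (f - c%:A))).
- by exists 0; rewrite scale0r subrr; apply: is_ideal0.
- move=> f1 f2 [c1 h1] [c2 h2]; exists (c1 + c2).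
  by rewrite scalerDl opprD addrACA; apply: is_idealD.
move=> u _; rewrite linearZ /=; have [->|u0] := eqVneq u 0%MM.
  by exists p@_0%MM; rewrite mpolyX0 rmorph1 subrr; apply: is_ideal0.
by exists 0; rewrite scale0r subr0; apply/edge_maxZ/edge_max_monomial.
Qed.

Lemma edge_max_genE : m = ideal_gen [set f | exists i, f = x i].
Proof.
apply/seteqP; split; first exact: edge_max_gen.
apply: ideal_gen_sub; first exact: edge_max_ideal.
by move=> _ [i ->]; apply: edge_maxX.
Qed.

Lemma edge_max_sqr_sub (K : set A) : is_ideal K ->
  (forall i j, K (x i * x j)) -> ideal_mul m m `<=` K.
Proof.
move=> iK Kx; apply: ideal_gen_sub => // _ [f [g [mf mg ->]]].
have Kxg i : K (x i * g).
  move: mg; rewrite edge_max_genE => -[s [sS ->]].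
  rewrite mulr_sumr big_seq; apply: is_ideal_sum => // t /sS[j ->].
  by rewrite mulrCA; apply: is_idealMl.
move: mf; rewrite edge_max_genE => -[s [sS ->]].
rewrite mulr_suml big_seq; apply: is_ideal_sum => // t /sS[j ->].
by rewrite -mulrA; apply: is_idealMl.
Qed.

Lemma edge_max_linear f : m f ->
  exists c : 'I_n -> k, ideal_mul m m (f - \sum_i c i *: x i).
Proof.
have m2I := ideal_mul_ideal m m.
rewrite edge_max_genE => -[s [sS ->]]; rewrite -edge_max_genE big_seq.
apply: (big_ind (fun f => exists c : 'I_n -> k, 
    ideal_mul m m (f - \sum_i c i *: x i))) => [|f1 f2 [c1 h1] [c2 h2]|t /sS[j ->]].
- exists (fun=> 0); rewrite big1 ?subr0; first exact: is_ideal0.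
  by move=> i _; rewrite scale0r.
- exists (fun i => c1 i + c2 i); under eq_bigr do rewrite scalerDl.
  by rewrite big_split opprD addrACA; apply: is_idealD.
have [c mc] := edge_ring_const t.1; exists (fun i => if i == j then c else 0).
rewrite (bigD1 j) //= eqxx big1 => [|i /negPf->]; last by rewrite scale0r.
by rewrite addr0 edge_scaleE -mulrBl; apply: ideal_mulM => //; apply: edge_maxX.
Qed.

(* Well defined on the edge ring, i.e. independent of [repr f], only when
   [indep_supp w] holds. *)
Definition line_restr (w : 'I_n -> k) (f : A) : {poly k} :=
  mmap polyC (fun i => w i *: 'X) (repr f).

Definition indep_supp (w : 'I_n -> k) := forall i j, G i j -> w i * w j = 0.

Section LineRestriction.
Variables (w : 'I_n -> k) (indw : indep_supp w).
Local Notation psi := (line_restr w).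

(** An edge monomial restricts to a multiple of [w i * w j = 0], so the choice of representative
    does not matter. *)
Lemma line_restr_proj p :
  psi (edge_proj G p) = mmap polyC (fun i => w i *: 'X) p.
Proof.
have /edge_projP : edge_proj G (repr (edge_proj G p)) = edge_proj G p.
  by rewrite /edge_proj generic_quotient.reprK.
rewrite /line_restr; set q := repr _ => -[s [sE pq]].
apply/eqP; rewrite -subr_eq0 -mmapB pq rmorph_sum /= big_seq big1 // => t /sE[i [j [Gij ->]]].
rewrite !rmorphM /= !mmapX !mmap1U -!mul_polyC mulrACA -polyCM indw //.
by rewrite mul0r mulr0.
Qed.

Lemma line_restrD f g : psi (f + g) = psi f + psi g.
Proof.
have [p ->] := edge_proj_surj f; have [q ->] := edge_proj_surj g.
by rewrite -rmorphD !line_restr_proj rmorphD.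
Qed.

Lemma line_restrM f g : psi (f * g) = psi f * psi g.
Proof.
have [p ->] := edge_proj_surj f; have [q ->] := edge_proj_surj g.
by rewrite -rmorphM !line_restr_proj rmorphM.
Qed.

Lemma line_restrZ c f : psi (c *: f) = c *: psi f.
Proof.
have [p ->] := edge_proj_surj f.
by rewrite -linearZ !line_restr_proj /= mmapZ mul_polyC.
Qed.

Lemma line_restr0 : psi 0 = 0.
Proof. by rewrite -(scale0r 0) line_restrZ scale0r. Qed.

Lemma line_restrX i : psi (x i) = w i *: 'X.
Proof. by rewrite line_restr_proj mmapX mmap1U. Qed.

Lemma line_restr1 : psi 1 = 1.
Proof. by rewrite -(rmorph1 (edge_proj G)) line_restr_proj rmorph1. Qed.

Lemma line_restr_sum (T : Type) (s : seq T) (P : pred T) (F : T -> A) :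
  psi (\sum_(t <- s | P t) F t) = \sum_(t <- s | P t) psi (F t).
Proof. exact: (big_morph psi line_restrD line_restr0). Qed.

Lemma line_restr_max0 f : m f -> (psi f)`_0 = 0.
Proof.
rewrite edge_max_genE => -[s [sX ->]].
rewrite line_restr_sum coef_sum big_seq big1 // => t /sX[i ->].
by rewrite line_restrM line_restrX -scalerAr coefZ coefMX eqxx mulr0.
Qed.

Lemma line_restr_coef1M f g : m f -> m g -> (psi (f * g))`_1 = 0.
Proof.
move=> /line_restr_max0 f0 /line_restr_max0 g0.
by rewrite line_restrM coefM !big_ord_recl big_ord0 /= f0 g0 mul0r mulr0 !addr0.
Qed.

Lemma line_restr_coef2M f g : m f -> m g ->
  (psi (f * g))`_2 = (psi f)`_1 * (psi g)`_1.
Proof.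
move=> /line_restr_max0 f0 /line_restr_max0 g0.
rewrite line_restrM coefM !big_ord_recl big_ord0 /=.
by rewrite f0 g0 mul0r mulr0 !addr0 add0r.
Qed.

Lemma line_restr_sqr1 f : ideal_mul m m f -> (psi f)`_1 = 0.
Proof.
move=> [s [sX ->]]; rewrite line_restr_sum coef_sum big_seq big1 // => t.
move=> /sX[g [h [mg mh ->]]]; rewrite mulrA line_restr_coef1M //.
by apply: is_idealMl => //; exact: edge_max_ideal.
Qed.

Lemma line_restr_linear (c : 'I_n -> k) f :
  ideal_mul m m (f - \sum_i c i *: x i) -> (psi f)`_1 = \sum_i c i * w i.
Proof.
move=> /line_restr_sqr1; rewrite -scaleN1r line_restrD line_restrZ coefD coefZ.
rewrite mulN1r => /eqP; rewrite subr_eq0 => /eqP ->.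
rewrite line_restr_sum coef_sum; apply: eq_bigr => i _.
by rewrite line_restrZ line_restrX !coefZ coefX mulr1.
Qed.

End LineRestriction.

Definition unit_pt (i : 'I_n) : 'I_n -> k := fun j => (j == i)%:R.

Lemma indep_unit_pt i : indep_supp (unit_pt i).
Proof.
move=> a b Gab; rewrite /unit_pt; have [ai|] := eqVneq a i; last by rewrite mul0r.
have [bi|] := eqVneq b i; last by rewrite mulr0.
by rewrite ai bi adj_irrefl in Gab.
Qed.

(** The coefficient of [x i] in the linear part of [f], read off along a coordinate axis; one vertex
    is an independent set. *)
Definition lin_coef (f : A) (i : 'I_n) : k := (line_restr (unit_pt i) f)`_1.

Lemma lin_coefP f : m f -> ideal_mul m m (f - \sum_i lin_coef f i *: x i).
Proof.
move=> /edge_max_linear[c m2c]; suff -> : f - \sum_i lin_coef f i *: x i = f - \sum_i c i *: x i by [].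
congr (_ - _); apply: eq_bigr => i _; congr (_ *: _).
rewrite /lin_coef (line_restr_linear _ m2c); last exact: indep_unit_pt.
rewrite (bigD1 i) //= /unit_pt eqxx mulr1 big1 ?addr0 // => j /negPf->.
by rewrite mulr0.
Qed.

Lemma line_restr1E w f : indep_supp w -> m f ->
  (line_restr w f)`_1 = \sum_i lin_coef f i * w i.
Proof. by move=> indw /lin_coefP/(line_restr_linear indw). Qed.

End EdgeRingTheory.

(** * Counting by dual families *)

Section CardDual.
Local Open Scope ring_scope.

(** The hypothesis factors an identity matrix of size [#|X|] through a space of dimension [#|Y|]. *)
Lemma card_le_dual (F : fieldType) (T U : finType) (X : {set T}) (Y : {set U})
    (c : T -> U -> F) (M : U -> T -> F) :
  {in X &, forall x x', \sum_(y in Y) c x y * M y x' = (x == x')%:R} ->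
  (#|X| <= #|Y|)%N.
Proof.
move=> cM; pose C := \matrix_(s < #|X|, t < #|Y|) c (enum_val s) (enum_val t).
pose N := \matrix_(t < #|Y|, s < #|X|) M (enum_val t) (enum_val s).
suff CN : C *m N = 1%:M.
  by rewrite -(mxrank1 F #|X|) -CN (leq_trans (mxrankM_maxl _ _)) ?rank_leq_col.
apply/matrixP => s s'; rewrite !mxE -(inj_eq enum_val_inj) -cM ?enum_valP //.
by rewrite [RHS]big_enum_val; apply: eq_bigr => t _; rewrite !mxE.
Qed.

End CardDual.

Lemma card_ord_le_pairs d : #|[set p : 'I_d * 'I_d | p.1 <= p.2]| = 'C(d.+1, 2).
Proof.
rewrite -sum1dep_card -(pair_big_dep xpredT (fun i j : 'I_d => i <= j) (fun _ _ => 1)) /=.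
rewrite (exchange_big_dep xpredT) //= -triangular_sum big_mkord big_ord_recl add0n.
apply: eq_bigr => j _; rewrite -(big_ord_widen d (fun=> 1) (ltn_ord j)).
by rewrite sum1_card card_ord.
Qed.

(** * Lower bounds on the number of generators *)

Section LowerBounds.
Local Open Scope ring_scope.
Local Open Scope classical_set_scope.

Variables (k : fieldType) (n : nat) (G : sgraph n).
Local Notation S := {mpoly k[n]}.
Local Notation A := (edge_ring k G).
Local Notation x i := (edge_proj G ('X_i : S)).
Local Notation m := (@edge_max k n G).
Implicit Types (w : 'I_n -> k) (f : A).

Lemma line_restr_span w e d (b : 'I_d -> A) (c : 'I_d -> k) f : indep_supp G w ->
  (line_restr w (f - \sum_i c i *: b i))`_e = 0 ->
  (line_restr w f)`_e = \sum_i c i * (line_restr w (b i))`_e.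
Proof.
move=> indw; rewrite -scaleN1r line_restrD // line_restrZ // coefD coefZ.
rewrite mulN1r => /eqP; rewrite subr_eq0 => /eqP ->.
by rewrite line_restr_sum // coef_sum; apply: eq_bigr => i _; rewrite line_restrZ // coefZ.
Qed.

(** This value is the residue of [f] modulo [m], which does not involve the point. *)
Lemma line_restr_coef0 w w' f : indep_supp G w -> indep_supp G w' ->
  (line_restr w f)`_0 = (line_restr w' f)`_0.
Proof.
move=> indw indw'; have [c mc] := edge_ring_const f.
suff E u : indep_supp G u -> (line_restr u f)`_0 = c by rewrite !E.
move=> indu; rewrite -(subrK (c%:A) f) line_restrD // coefD.
by rewrite line_restr_max0 // line_restrZ // line_restr1 // add0r coefZ coef1 mulr1.
Qed.

Section Generators.
Variables (J : set A) (d : nat) (b : 'I_d -> A).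
Hypothesis Jm : J `<=` m.
Hypothesis bJ : forall i, J (b i).
Hypothesis spanJ : forall f, J f ->
  exists c : 'I_d -> k, ideal_mul m J (f - \sum_i c i *: b i).

(** The error term lies in [m J], hence in [m^2], and has no linear part. One [c] serves all points
    [w]. *)
Lemma span_coef1 f : J f -> exists c : 'I_d -> k, forall w, indep_supp G w ->
  (line_restr w f)`_1 = \sum_i c i * (line_restr w (b i))`_1.
Proof.
move=> /spanJ[c mJc]; exists c => w indw; apply: line_restr_span => //.
by apply: line_restr_sqr1 => //; apply: ideal_mulS mJc.
Qed.

Lemma span_sqr_coef2 f : ideal_mul J J f ->
  exists c : 'I_d * 'I_d -> k, forall w, indep_supp G w ->
  (line_restr w f)`_2 =
    \sum_p c p * ((line_restr w (b p.1))`_1 * (line_restr w (b p.2))`_1).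
Proof.
move=> [s [sJ ->]]; rewrite big_seq.
pose P f := exists c : 'I_d * 'I_d -> k, forall w, indep_supp G w ->
  (line_restr w f)`_2 =
    \sum_p c p * ((line_restr w (b p.1))`_1 * (line_restr w (b p.2))`_1).
rewrite -/(P _); apply: (big_ind P).
- exists (fun=> 0) => w indw; rewrite line_restr0 // coef0 big1 // => p _.
  by rewrite mul0r.
- move=> f1 f2 [c1 h1] [c2 h2]; exists (fun p => c1 p + c2 p) => w indw.
  rewrite line_restrD // coefD h1 // h2 // -big_split; apply: eq_bigr => p _.
  by rewrite mulrDl.
move=> [a _] /sJ/= [g [h [Jg Jh ->]]].
have [cg gE] := span_coef1 Jg; have [ch hE] := span_coef1 Jh.
have ind0 : indep_supp G (fun=> 0 : k) by move=> i j _; rewrite mul0r.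
(* Only the constant term of [a] contributes in degree 2; it is read at the origin to make the
   coefficients independent of [w]. *)
exists (fun p => (line_restr (fun=> 0) a)`_0 * (cg p.1 * ch p.2)) => w indw.
rewrite line_restrM // coefM !big_ord_recl big_ord0 /=.
rewrite (line_restr_coef0 _ indw ind0) line_restr_coef2M //; try exact: Jm.
rewrite line_restr_coef1M //; try exact: Jm.
rewrite [(line_restr w (g * h))`_0]line_restr_max0 //; last first.
  by apply: is_idealMl; [exact: edge_max_ideal|exact: Jm].
rewrite !mulr0 !addr0 gE // hE // big_distrlr pair_big mulr_sumr /=.
by apply: eq_bigr => p _; ring.
Qed.

(** Under the hypothesis elements of [J] restrict to order at least 2, so those of [m J] restrict to
    order at least 3. *)
Lemma mul_max_coef2 w f : indep_supp G w ->
  (forall i, (line_restr w (b i))`_1 = 0) -> ideal_mul m J f ->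
  (line_restr w f)`_2 = 0.
Proof.
move=> indw b0 [s [sJ ->]]; rewrite line_restr_sum // coef_sum big_seq big1 //.
move=> [a _] /sJ/= [g [h [mg Jh ->]]]; rewrite mulrA line_restr_coef2M //.
- have [c ->//] := span_coef1 Jh.
  by rewrite big1 ?mulr0 // => i _; rewrite b0 mulr0.
- by apply: is_idealMl => //; apply: edge_max_ideal.
- exact: Jm.
Qed.

Lemma span_sqr_card : ideal_mul m m `<=` ideal_mul J J ->
  (#|[set p : 'I_n * 'I_n | (p.1 <= p.2)%N && ~~ G p.1 p.2]%SET| <= 'C(d.+1, 2))%N.
Proof.
move=> m2J2; rewrite -card_ord_le_pairs.
have xJ2 (p : 'I_n * 'I_n) : ideal_mul J J (x p.1 * x p.2).
  by apply: m2J2; apply: ideal_mulM; apply: edge_maxX.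
have /choice[c cP] p := span_sqr_coef2 (xJ2 p).
pose l i t := lin_coef (b i) t.
(* The coefficient of the monomial indexed by [q] in the product of the linear parts of [b z.1] and
   [b z.2]. *)
pose N (z : 'I_d * 'I_d) (q : 'I_n * 'I_n) : k :=
  if q.1 == q.2 then l z.1 q.1 * l z.2 q.1
  else l z.1 q.1 * l z.2 q.2 + l z.1 q.2 * l z.2 q.1.
(* Sorting the pair: [N] is symmetric in [z], so only the ['C(d.+1, 2)] sorted pairs count. *)
pose h (z : 'I_d * 'I_d) := if (z.1 <= z.2)%N then z else (z.2, z.1).
have Nh z q : N z q = N (h z) q.
  by rewrite /N /h; case: ifP => // _; case: ifP => _ /=; ring.
have cw p w : indep_supp G w ->
    \sum_z c p z * ((line_restr w (b z.1))`_1 * (line_restr w (b z.2))`_1) = w p.1 * w p.2.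
  move=> indw; rewrite -cP // line_restrM // !line_restrX //.
  by rewrite -scalerAl -scalerAr !coefZ -expr2 coefXn mulr1.
have cN (p q : 'I_n * 'I_n) : (p.1 <= p.2)%N -> (q.1 <= q.2)%N -> ~~ G q.1 q.2 ->
    \sum_z c p z * N z q = (p == q)%:R.
  case: p => a a'; case: q => u v /= aa' uv Guv.
  have cu t : \sum_z c (a, a') z * (l z.1 t * l z.2 t) = (a == t)%:R * (a' == t)%:R.
    exact: (cw (a, a') _ (indep_unit_pt k t)).
  rewrite /N /= xpair_eqE; have [<-|uv'] := eqVneq u v.
    by rewrite cu -natrM mulnb.
  (* Polarization: [u] and [v] are not adjacent, so their sum is an admissible point; removing the
     values at [u] and at [v] leaves the mixed coefficient. *)
  pose w i := unit_pt k u i + unit_pt k v i.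
  have indw : indep_supp G w.
    move=> i j Gij; rewrite /w !mulrDl !mulrDr !(indep_unit_pt k _ Gij) add0r addr0 /unit_pt.
    have uv0 a1 a2 : G a1 a2 -> (a1 == u)%:R * (a2 == v)%:R = 0 :> k.
      move=> Ga; rewrite -natrM mulnb; case: eqP => //= a1u; case: eqP => //= a2v.
      by rewrite -a1u -a2v Ga in Guv.
    by rewrite uv0 // [X in _ + X]mulrC uv0 ?addr0 // adj_sym.
  have bw i : (line_restr w (b i))`_1 = l i u + l i v.
    rewrite line_restr1E //; last exact/Jm/bJ.
    rewrite /w; under eq_bigr do rewrite mulrDr.
    rewrite big_split /= /unit_pt (bigD1 u) //= eqxx mulr1 big1; last first.
      by move=> t /negPf->; rewrite mulr0.
    rewrite addr0 (bigD1 v) //= eqxx mulr1 big1 ?addr0 // => t /negPf->.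
    by rewrite mulr0.
  transitivity (w a * w a' - (a == u)%:R * (a' == u)%:R - (a == v)%:R * (a' == v)%:R).
    rewrite -(cw (a, a') w indw) -(cu u) -(cu v) -!sumrB.
    by apply: eq_bigr => z _; rewrite !bw; ring.
  (* The swapped match would force [v <= u], against [u <= v] and [u != v]. *)
  have av0 : (a == v)%:R * (a' == u)%:R = 0 :> k.
    rewrite -natrM mulnb; case: eqP => //= av; case: eqP => //= a'u.
    by case/negP: uv'; rewrite -val_eqE eqn_leq uv -av -a'u aa'.
  rewrite -mulnb natrM -[RHS]addr0 -{}av0 /w /unit_pt; ring.
rewrite (@card_le_dual k _ _ _ [set z : 'I_d * 'I_d | (z.1 <= z.2)%N]%SET
  (fun p y => \sum_(z | h z == y) c p z) N) // => p q.
rewrite !inE => /andP[p12 _] /andP[q12 Gq]; rewrite -(cN p q) //.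
rewrite [RHS](partition_big h (mem [set z : 'I_d * 'I_d | (z.1 <= z.2)%N]%SET)) /=.
  apply: eq_bigr => y _; rewrite mulr_suml; apply: eq_bigr => z /eqP <-.
  by rewrite -Nh.
by move=> z _; rewrite inE /h; case: ifP => //= /negbT; rewrite -ltnNge => /ltnW.
Qed.

End Generators.

Section IndependentSet.
Variables (r : nat) (e : 'I_r -> 'I_n).
Hypothesis (e_inj : injective e) (e_indep : forall s t, ~~ G (e s) (e t)).

(** Since [e] is injective, this extends [v] by zero outside the independent set. *)
Definition spread (v : 'I_r -> k) : 'I_n -> k := fun i => \sum_s (e s == i)%:R * v s.

Lemma spreadE v s : spread v (e s) = v s.
Proof.
rewrite /spread (bigD1 s) //= eqxx mul1r big1 ?addr0 // => t ts.
by rewrite (inj_eq e_inj) (negPf ts) mul0r.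
Qed.

Lemma spread_indep v : indep_supp G (spread v).
Proof.
move=> i j Gij; rewrite big_distrlr big1 //= => s _; rewrite big1 // => t _.
case: eqVneq => [ei|]; last by rewrite !mul0r.
case: eqVneq => [ej|]; last by rewrite mul0r mulr0.
by have := e_indep s t; rewrite ei ej Gij.
Qed.

Lemma line_restr_spread1 v f : m f ->
  (line_restr (spread v) f)`_1 = \sum_s lin_coef f (e s) * v s.
Proof.
move=> mf; rewrite line_restr1E //; last exact: spread_indep.
under eq_bigr do rewrite mulr_sumr.
rewrite exchange_big; apply: eq_bigr => s _.
rewrite (bigD1 (e s)) //= eqxx mul1r big1 ?addr0 // => i.
by rewrite eq_sym => /negPf->; rewrite mul0r mulr0.
Qed.

Lemma is_ms_val_ge_indep d : is_ms_val k G d -> (r <= d)%N.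
Proof.
move=> [J [_ Jm m2J [b [bJ spanJ _]]]].
pose L := \matrix_(j < d, s < r) lin_coef (b j) (e s).
(* The rows of [W] are a basis of the points on the independent set where all linear parts vanish;
   the columns of [Y] give the dual coordinates [y s]. *)
pose W := row_base (kermx L^T); pose Y := pinvmx W.
have WY : W *m Y = 1%:M by apply: mulmxVp; apply: row_base_free.
pose w t := spread (W t).
have indw t : indep_supp G (w t) by exact: spread_indep.
have bw0 t j : (line_restr (w t) (b j))`_1 = 0.
  have /sub_kermxP/matrixP/(_ t j) : (W <= kermx L^T)%MS by rewrite eq_row_base.
  rewrite !mxE => {2}<-; rewrite line_restr_spread1; last exact: Jm.
  by apply: eq_bigr => s _; rewrite !mxE mulrC.
pose y s : A := \sum_a Y a s *: x (e a).
have my s : m (y s).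
  by apply: is_ideal_sum => [|a _]; [exact: edge_max_ideal|exact/edge_maxZ/edge_maxX].
have yw t s : (line_restr (w t) (y s))`_1 = (t == s)%:R.
  have /matrixP/(_ t s) := WY; rewrite !mxE => <-.
  rewrite line_restr_sum // coef_sum; apply: eq_bigr => a _.
  by rewrite line_restrZ // line_restrX // !coefZ coefX mulr1 /w spreadE mulrC.
have m2y s : ideal_mul m m (y s * y s) by exact: ideal_mulM.
have /choice[c cP] s := spanJ _ (m2J _ (m2y s)).
pose C := \matrix_(s, j) c s j.
(* The squares [y s * y s] have no linear part, so neither do their expansions in the [b j]. *)
have CL : C *m L = 0.
  apply/matrixP => s a; rewrite !mxE.
  rewrite -[RHS](line_restr_sqr1 (indep_unit_pt k (e a)) (m2y s)).
  rewrite (line_restr_span (c := c s) (b := b)); last 2 first.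
  - exact: indep_unit_pt.
  - apply: line_restr_sqr1; first exact: indep_unit_pt.
    by move: (cP s); apply: ideal_mulS.
  by apply: eq_bigr => j _; rewrite !mxE.
pose Q := \matrix_(j, t) (line_restr (w t) (b j))`_2.
(* Compare degree 2 at [w t]: there [m J] contributes nothing, and the square of [y s] takes the
   value [(s == t)%:R]. *)
have CQ : C *m Q = 1%:M.
  apply/matrixP => s t; rewrite !mxE.
  transitivity ((line_restr (w t) (y s * y s))`_2).
    rewrite (line_restr_span (c := c s) (b := b)) //; last first.
      by apply: (mul_max_coef2 Jm spanJ) (cP s).
    by apply: eq_bigr => j _; rewrite !mxE.
  by rewrite line_restr_coef2M // !yw eq_sym; case: eqP; rewrite ?mulr1 ?mulr0.
(* This reads [r - \rank L <= \rank C], while [C *m L = 0] gives [\rank C + \rank L <= d]. *)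
have rC : (\rank (kermx L^T) <= \rank C)%N.
  by rewrite -[leqLHS](mxrank1 k) -CQ mxrankM_maxl.
have := mulmx0_rank_max CL; apply: leq_trans.
by move: rC; rewrite {1}mxrank_ker mxrank_tr addnC -leq_subLR.
Qed.

End IndependentSet.
End LowerBounds.

(** * Ideals generated by linear forms, and merging of vertices *)

Section LinearIdeals.
Local Open Scope ring_scope.
Local Open Scope classical_set_scope.

Variables (k : fieldType) (n : nat) (G : sgraph n).
Local Notation S := {mpoly k[n]}.
Local Notation A := (edge_ring k G).
Local Notation x i := (edge_proj G ('X_i : S)).
Local Notation m := (@edge_max k n G).

Lemma lin_coefX i j : lin_coef (x i) j = (i == j)%:R.
Proof.
by rewrite /lin_coef line_restrX ?coefZ ?coefX ?mulr1 //; exact: indep_unit_pt.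
Qed.

Lemma lin_coefD f g j : lin_coef (f + g : A) j = lin_coef f j + lin_coef g j.
Proof. by rewrite /lin_coef line_restrD ?coefD //; exact: indep_unit_pt. Qed.

Lemma lin_coefZ c f j : lin_coef (c *: f : A) j = c * lin_coef f j.
Proof. by rewrite /lin_coef line_restrZ ?coefZ //; exact: indep_unit_pt. Qed.

Lemma lin_coef_sqr f j : ideal_mul m m f -> lin_coef f j = 0.
Proof. by apply: line_restr_sqr1; exact: indep_unit_pt. Qed.

(** A relation among the [l i] modulo [m J] has zero linear part, and its coefficient at the vertex
    [v i] is [c i]. *)
Lemma linear_ideal_mu d (l : 'I_d -> A) (v : 'I_d -> 'I_n)
    (J := ideal_gen [set f | exists i, f = l i]) :
    (forall i, is_homog (l i)) -> (forall i, m (l i)) ->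
    (forall i j, lin_coef (l i) (v j) = (i == j)%:R) ->
  [/\ homog_ideal J, J `<=` m & has_mu J d].
Proof.
move=> lh lm lv; have JI : is_ideal J by exact: ideal_genP.
have lJ i : J (l i) by apply: sub_ideal_gen; exists i.
have Jm : J `<=` m.
  by apply: ideal_gen_sub; [exact: edge_max_ideal|move=> _ [i ->]].
split=> //.
  split=> //; apply/seteqP; split; apply: ideal_gen_sub => //.
  - exact: ideal_genP.
  - by move=> _ [i ->]; apply: sub_ideal_gen.
  - by move=> f [].
exists l; split=> // [f [s [sJ ->]]|c mJc i].
  rewrite big_seq.
  pose P f := exists c : 'I_d -> k, ideal_mul m J (f - \sum_i c i *: l i).
  rewrite -/(P _); apply: (big_ind P) => [|f1 f2 [c1 h1] [c2 h2]|[a _] /sJ/= [i ->]].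
  - exists (fun=> 0); rewrite big1 ?subrr; first exact: is_ideal0 (ideal_mul_ideal _ _).
    by move=> i _; rewrite scale0r.
  - exists (fun i => c1 i + c2 i); under eq_bigr do rewrite scalerDl.
    by rewrite big_split opprD addrACA; apply: is_idealD => //; exact: ideal_mul_ideal.
  have [c mc] := edge_ring_const a; exists (fun j => if j == i then c else 0).
  rewrite (bigD1 i) //= eqxx big1 => [|j /negPf->]; last by rewrite scale0r.
  by rewrite addr0 edge_scaleE -mulrBl; apply: ideal_mulM.
have : ideal_mul m m (\sum_i c i *: l i) by move: mJc; apply: ideal_mulS.
move=> /lin_coef_sqr - /(_ (v i)).
rewrite /lin_coef line_restr_sum; last exact: indep_unit_pt.
rewrite coef_sum; under eq_bigr => j _ do rewrite -/(lin_coef _ _) lin_coefZ lv.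
rewrite (bigD1 i) //= eqxx mulr1 big1 ?addr0 // => j /negPf->.
by rewrite mulr0.
Qed.

Lemma linear_form_homog (c : 'I_n -> k) : is_homog (\sum_i c i *: x i).
Proof.
exists 1, (\sum_i c i *: 'X_i); split; last first.
  by rewrite linear_sum; apply: eq_bigr => i _; rewrite linearZ.
by apply: rpred_sum => i _; apply: rpredZ; rewrite dhomogX /= mdeg1.
Qed.

Section Contraction.
Variables (r : 'I_n -> 'I_n) (r_idem : forall i, r (r i) = r i).

Definition contraction_ideal : set A := ideal_gen [set f | exists i, f = x i - x (r i)].
Local Notation J := contraction_ideal.

Lemma contraction_ideal_ideal : is_ideal J.
Proof. exact: ideal_genP. Qed.

Lemma contraction_idealB i j : r i = r j -> J (x i - x j).
Proof.
have JI := contraction_ideal_ideal.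
have xJ a : J (x a - x (r a)) by apply: sub_ideal_gen; exists a.
move=> rij; have -> : x i - x j = (x i - x (r i)) - (x j - x (r j)) by rewrite rij; ring.
exact: is_idealB.
Qed.

(** Fixed vertices give zero generators. The variable of a moved vertex occurs only in its own
    generator, because values of [r] are fixed. *)
Lemma contraction_ideal_mu :
  [/\ homog_ideal J, J `<=` m & has_mu J #|[set i | r i != i]%SET|].
Proof.
pose v := @enum_val _ (mem [set i | r i != i]%SET).
pose l i := x (v i) - x (r (v i)).
have -> : J = ideal_gen [set f | exists i, f = l i].
  apply/seteqP; split; apply: ideal_gen_sub; try exact: ideal_genP; move=> _ [i ->].
    have [ri|ri] := eqVneq (r i) i.
      by rewrite ri subrr; apply: is_ideal0; exact: ideal_genP.
    have ii : i \in [set i | r i != i]%SET by rewrite inE.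
    apply: sub_ideal_gen; exists (enum_rank_in ii i).
    by rewrite /l /v enum_rankK_in.
  by apply: sub_ideal_gen; exists (v i).
apply: (linear_ideal_mu (v := v)) => [i|i|i j].
- exists 1, ('X_(v i) - 'X_(r (v i))); rewrite rmorphB; split=> //.
  by apply: rpredB; rewrite dhomogX /= mdeg1.
- by apply: is_idealB; [exact: edge_max_ideal|exact: edge_maxX|exact: edge_maxX].
have vj : r (v i) != v j.
  have := enum_valP j; rewrite -/(v j) inE; apply: contraNneq => <-.
  by rewrite r_idem.
rewrite /l -scaleN1r lin_coefD lin_coefZ !lin_coefX (negPf vj) mulr0 addr0.
by rewrite (inj_eq enum_val_inj).
Qed.

(** Modulo [J] the product [x i * x j] equals [x i' * x j'], which is zero along an edge. *)
Lemma contraction_ms_val :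
  (forall i j, exists i' j', [/\ r i' = r i, r j' = r j & G i' j']) ->
  is_ms_val k G #|[set i | r i != i]%SET|.
Proof.
move=> rG; have [homJ Jm muJ] := contraction_ideal_mu; exists J; split=> //.
have JI := contraction_ideal_ideal.
apply: edge_max_sqr_sub => // i j; have [i' [j' [ri rj Gij]]] := rG i j.
have -> : x i * x j = (x i - x i') * x j + x i' * (x j - x j').
  by rewrite mulrBl mulrBr (edge_proj_edge k Gij) subr0 subrK.
have Jii' := contraction_idealB (esym ri); have Jjj' := contraction_idealB (esym rj).
by apply: (is_idealD JI); [exact: (is_idealMr (x j) JI)|exact: (is_idealMl _ JI)].
Qed.

End Contraction.
End LinearIdeals.

(** * Bounds on [cs] and [ms], and lower bounds for cycles *)

Lemma cs_le k n (G : sgraph n) d : is_cs_val k G d -> cs k G <= d.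
Proof. by move=> csd; rewrite /cs; case: ex_minnP => c _; apply; apply/asboolP. Qed.

Lemma cs_spec k n (G : sgraph n) : is_cs_val k G (cs k G).
Proof. by rewrite /cs; case: ex_minnP => c /asboolP. Qed.

Lemma ms_le k n (G : sgraph n) d : is_ms_val k G d -> ms k G <= d.
Proof. by move=> msd; rewrite /ms; case: ex_minnP => c _; apply; apply/asboolP. Qed.

Lemma ms_spec k n (G : sgraph n) : is_ms_val k G (ms k G).
Proof. by rewrite /ms; case: ex_minnP => c /asboolP. Qed.

Lemma cs_le_order k n (G : sgraph n) : cs k G <= n.
Proof.
apply: cs_le; exists (@edge_max k n G); split=> //; first exact: edge_max_homog.
exact: edge_max_mu.
Qed.

Lemma cs_ge_nonedges k n (G : sgraph n) :
  #|[set p : 'I_n * 'I_n | (p.1 <= p.2) && ~~ G p.1 p.2]| <= 'C((cs k G).+1, 2).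
Proof.
have [J [_ Jm J2 [b [bJ spanJ _]]]] := cs_spec k G.
by apply: (span_sqr_card Jm bJ spanJ); rewrite J2.
Qed.

Lemma cycle_nonedges n : 'C(n, 2) <=
  #|[set p : 'I_n * 'I_n | (p.1 <= p.2) && ~~ cycle_graph n p.1 p.2]|.
Proof.
set N := [set _ | _]; pose T := [set p : 'I_n * 'I_n | p.1 <= p.2].
have cT : #|T| = 'C(n, 2) + n by rewrite card_ord_le_pairs binS bin1.
pose E := [set p : 'I_n * 'I_n | cycle_adj p.1 p.2].
have NE : N = T :\: E by apply/setP => p; rewrite !inE andbC.
suff : #|T :&: E| <= n by rewrite NE; have := cardsID E T; lia.
(* Edges inject into vertices: a consecutive pair goes to its smaller end, the closing edge to the
   last vertex. *)
pose f (p : 'I_n * 'I_n) := if p.1.+1 == p.2 :> nat then p.1 else p.2.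
rewrite -(card_in_imset (f := f)) => [|[a b] [c d]].
  by rewrite -[leqRHS]card_ord max_card.
rewrite !inE /f /cycle_adj -!val_eqE /= => /andP[ab abE] /andP[cd cdE] fE.
have {fE} : (if a.+1 == b :> nat then a : nat else b) = (if c.+1 == d :> nat then c : nat else d).
  by move: fE; do 2 case: ifP => _; move=> ->.
move=> fE; suff [ac bd] : a = c :> nat /\ b = d :> nat.
  by congr pair; apply: val_inj.
have := ltn_ord a; have := ltn_ord b; have := ltn_ord c; have := ltn_ord d.
by move: fE abE cdE ab cd; do 2 case: ifP; lia.
Qed.

Lemma cs_cycle_ge k n : n - 1 <= cs k (cycle_graph n).
Proof.
rewrite leq_subLR add1n leqNgt; apply/negP => cn.
have := leq_trans (cycle_nonedges n) (cs_ge_nonedges k (cycle_graph n)).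
by apply/negP; rewrite -ltnNge (leq_trans _ (leq_bin2l 2 cn)) // [ltnRHS]binS bin1 -addn1 leq_add2l.
Qed.

(** The vertices [s.*2] with [s < n./2] are independent; for odd [n >= 3] this leaves out the last
    vertex, a neighbour of [0]. *)
Lemma ms_cycle_ge k n : n./2 <= ms k (cycle_graph n).
Proof.
have e_lt (s : 'I_(n./2)) : s.*2 < n by have := ltn_ord s; lia.
apply: (@is_ms_val_ge_indep k n _ _ (fun s => Ordinal (e_lt s))); last exact: ms_spec.
  by move=> s t [/double_inj st]; apply: val_inj.
move=> s t /=; rewrite /cycle_adj -!val_eqE /=.
by have := ltn_ord s; have := ltn_ord t; lia.
Qed.

(** * The value of [cs] on odd cycles, with [n.+1] vertices *)

Section OddCycle.
Variables (k : fieldType) (n : nat).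
Hypotheses (n_gt1 : 1 < n) (n_even : ~~ odd n).
Local Notation G := (cycle_graph n.+1).
Local Notation x i := (edge_proj G ('X_i : {mpoly k[n.+1]})).

Let o t : 'I_n.+1 := Ordinal (ltn_pmod t (ltn0Sn n)).

Let o_adj t : cycle_adj (o t) (o t.+1).
Proof.
rewrite /cycle_adj -!val_eqE /= -[t.+1]addn1 -modnDml addn1.
have := ltn_pmod t (ltn0Sn n); move: (t %% n.+1) => a an.
have [->|aN] := eqVneq a n; first by rewrite modnn; lia.
by rewrite modn_small; lia.
Qed.

Let o_step (i j : 'I_n.+1) : exists s, o (i.+1 + s.*2) = j.
Proof.
(* The number of full turns added to make the distance from [i.+1] to [j] even; one or two suffice
   as [n.+1] is odd. *)
pose c := if odd (j + n.+1 - i.+1) then 2 else 1.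
exists (j + c * n.+1 - i.+1)./2; apply: val_inj => /=.
have := ltn_ord i; have := ltn_ord j => jn iN.
rewrite -[RHS](modn_small (ltn_ord j)) -[RHS](modnMDl c).
congr (_ %% _); rewrite /c; case: ifP; lia.
Qed.

Lemma cs_val_odd_cycle : is_cs_val k G n.
Proof.
pose r (i : 'I_n.+1) : 'I_n.+1 := ord0.
have [homJ Jm muJ] := @contraction_ideal_mu k n.+1 G r (fun=> erefl).
set J := @contraction_ideal k n.+1 G r in homJ Jm muJ.
exists J; split=> //; last first.
  suff r_card : #|[set i | r i != i]%SET| = n by rewrite r_card in muJ.
  rewrite -[RHS]/(n.+1.-1) -[n.+1 in RHS]card_ord -(cardC1 (ord0 : 'I_n.+1)).
  by rewrite cardsE; apply: eq_card => i; rewrite !inE eq_sym.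
have J2I : is_ideal (ideal_mul J J) by exact: ideal_mul_ideal.
apply/seteqP; split; first exact: ideal_mulS.
apply: edge_max_sqr_sub => // j i; have [s <-] := o_step i j.
have xB a b : J (x a - x b)%R by apply: contraction_idealB.
have xx t : (x (o t) * x (o t.+1) = 0)%R by apply: edge_proj_edge; apply: o_adj.
elim: s => [|s IH].
  have iE : o i = i by apply: val_inj; rewrite /= modn_small.
  have -> : (x (o (i.+1 + 0)) * x i = 0)%R by rewrite addn0 mulrC -[RHS](xx i) iE.
  exact: is_ideal0 J2I.
rewrite doubleS !addnS; set t := i.+1 + s.*2 in IH *.
(* Both products with [x (o t.+1)] vanish along edges, so a step of length 2 changes the product by
   an element of [J^2]. *)
have -> : (x (o t.+2) * x i =
    x (o t) * x i - (x (o t) - x (o t.+2)) * (x i - x (o t.+1)))%R.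
  rewrite mulrBr !mulrBl xx [(x (o t.+2) * x (o t.+1))%R]mulrC xx subrr subr0.
  by rewrite opprB subrKC.
by apply: is_idealB => //; apply: ideal_mulM.
Qed.

End OddCycle.

(** * Upper bounds on [ms] for small cycles *)

Lemma ms_val_triangle k : is_ms_val k (cycle_graph 3) 1.
Proof.
pose G := cycle_graph 3; pose x i := edge_proj G ('X_i : {mpoly k[3]}).
pose l (_ : 'I_1) := (\sum_i x i)%R.
have Kx i j : i != j -> (x i * x j = 0)%R.
  move=> ij; apply: edge_proj_edge; rewrite /= /cycle_adj ij /=.
  by move: ij (ltn_ord i) (ltn_ord j); rewrite -val_eqE /=; lia.
have lE : l ord0 = (\sum_i 1 *: x i)%R by apply: eq_bigr => i _; rewrite scale1r.
have mI := edge_max_ideal k G.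
have [||i j|homJ Jm muJ] := @linear_ideal_mu k 3 G 1 l (fun=> ord0).
- by move=> i; rewrite [i]ord1 lE; apply: linear_form_homog.
- by move=> i; apply: is_ideal_sum => // j _; apply: edge_maxX.
- rewrite /l !ord1 eqxx !big_ord_recl big_ord0 addr0 !lin_coefD !lin_coefX.
  by rewrite eqxx !addr0.
eexists; split; [exact: homJ|exact: Jm| |exact: muJ].
have JI := ideal_genP [set f | exists i, f = l i]%classic.
apply: edge_max_sqr_sub => // i j; rewrite -/(x i) -/(x j).
have [<-|ij] := eqVneq i j; last by rewrite Kx //; apply: is_ideal0 JI.
(* In a triangle distinct variables multiply to zero, so only the square survives. *)
have -> : (x i * x i = x i * l ord0)%R.
  rewrite /l (bigD1 i) //= mulrDr mulr_sumr big1 ?addr0 // => a ai.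
  by rewrite Kx // eq_sym.
by apply: (is_idealMl _ JI); apply: sub_ideal_gen; exists ord0.
Qed.

(* For odd [n] the last class has three elements. *)
Definition pair_rep n i := (minn i (n - 2))./2.*2.

Lemma pair_rep_le n i : pair_rep n i <= i.
Proof. rewrite /pair_rep; lia. Qed.

Lemma pair_rep_idem n i : pair_rep n (pair_rep n i) = pair_rep n i.
Proof. rewrite /pair_rep; lia. Qed.

Lemma pair_rep_adj n i j : 4 <= n <= 7 -> i < n -> j < n ->
  exists i' j', [/\ i' < n, j' < n, pair_rep n i' = pair_rep n i, pair_rep n j' = pair_rep n j &
    [|| i'.+1 == j', j'.+1 == i', (i' == 0) && (j' == n.-1) | (j' == 0) && (i' == n.-1)]].
Proof.
move=> n47 iN jN.
(* The claim for [n] from 4 to 7 as a boolean over finite ranges, decided by computation. *)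
have : all (fun n => all (fun i => all (fun j => has (fun i' => has (fun j' =>
   [&& pair_rep n i' == pair_rep n i, pair_rep n j' == pair_rep n j &
    [|| i'.+1 == j', j'.+1 == i', (i' == 0) && (j' == n.-1) | (j' == 0) && (i' == n.-1)]])
   (iota 0 n)) (iota 0 n)) (iota 0 n)) (iota 0 n)) (iota 4 4) by vm_compute.
move=> /allP/(_ n); rewrite mem_iota => /(_ n47)/allP/(_ i).
rewrite mem_iota => /(_ iN)/allP/(_ j); rewrite mem_iota => /(_ jN)/hasP[i'].
rewrite mem_iota /= add0n => i'N /hasP[j']; rewrite mem_iota /= add0n => j'N.
by move=> /and3P[/eqP ri /eqP rj adj]; exists i', j'.
Qed.

(** Halving is injective on moved vertices: these are the odd ones and, for odd [n >= 3], the last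
    one, whose half exceeds the others. *)
Lemma pair_rep_card n : #|[set i : 'I_n | pair_rep n i != i]| <= uphalf n.
Proof.
have h_lt (i : 'I_n) : i./2 < uphalf n by have := ltn_ord i; lia.
rewrite -[leqRHS]card_ord -(card_in_imset (f := fun i => Ordinal (h_lt i))).
  exact: max_card.
move=> i j; rewrite !inE /pair_rep => ri rj [ij]; apply: val_inj => /=.
by have := ltn_ord i; have := ltn_ord j; lia.
Qed.

Lemma ms_small_cycle_le k n : 4 <= n <= 7 -> ms k (cycle_graph n) <= uphalf n.
Proof.
move=> n47; have r_lt (i : 'I_n) : pair_rep n i < n.
  exact: leq_ltn_trans (pair_rep_le n i) (ltn_ord i).
pose r (i : 'I_n) : 'I_n := Ordinal (r_lt i).
apply: leq_trans (pair_rep_card n); apply: ms_le.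
have -> : [set i : 'I_n | pair_rep n i != i] = [set i | r i != i].
  by apply/setP => i; rewrite !inE.
apply: contraction_ms_val => [i|i j].
  by apply: val_inj; apply: pair_rep_idem.
have [i' [j' [iN jN ri rj ij]]] := pair_rep_adj n47 (ltn_ord i) (ltn_ord j).
exists (Ordinal iN), (Ordinal jN); split; try exact: val_inj.
rewrite /= /cycle_adj ij andbT -val_eqE /=; lia.
Qed.

Theorem proposition6p29 (k : fieldType) (n : nat) (hn : 3 <= n) :
  [/\ (n - 1 <= cs k (cycle_graph n)) /\ (cs k (cycle_graph n) <= n),
      n./2 <= ms k (cycle_graph n),
      odd n -> cs k (cycle_graph n) = n - 1,
      n = 3 -> ms k (cycle_graph n) = n./2
    & (n <= 7 -> ms k (cycle_graph n) <= uphalf n) /\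
      (n = 4 \/ n = 6 -> ms k (cycle_graph n) = uphalf n)].
Proof.
have ms_ge := ms_cycle_ge k n; have cs_ge := cs_cycle_ge k n.
have ms3 : n = 3 -> ms k (cycle_graph n) = n./2.
  move=> n3; apply/eqP; rewrite eqn_leq ms_ge andbT n3.
  exact: ms_le (ms_val_triangle k).
have ms7 : n <= 7 -> ms k (cycle_graph n) <= uphalf n.
  (* The triangle is separate: its bound follows from the exact value. *)
  have [/ms3 -> _|n3 n7] := eqVneq n 3; first by rewrite uphalf_half leq_addl.
  by apply: ms_small_cycle_le; lia.
split=> //; first by split=> //; apply: cs_le_order.
  case: n hn {ms_ge ms3 ms7} cs_ge => // n n2 cs_ge odd_n; apply/eqP.
  by rewrite eqn_leq cs_ge andbT subn1; apply/cs_le/cs_val_odd_cycle.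
split=> // n46; apply/eqP; rewrite eqn_leq ms7 /=; last lia.
by move: ms_ge; case: n46 => ->.
Qed.
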